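(* For any orientation $\mathbb{O} = (n, \mathbb{O}^+, \mathbb{O}^-)$ (with $\mathbb{O}^+, \mathbb{O}^- \subseteq [n]$ arbitrary), the set $\mathsf{PEP}(\mathbb{O})$ of permutree element posets induces a sublattice of the lattice $(\mathsf{WOIP}(n), \preccurlyeq, \wedge_{\mathsf{WOIP}}, \vee_{\mathsf{WOIP}})$ of weak order interval posets.
   Context: $[n] = \{1,\dots,n\}$. All posets are reflexive relations on $[n]$. For a poset $\vartriangleleft$ let ${\vartriangleleft}^{\mathsf{Inc}} = \{(a,b) : a\le b,\ a \vartriangleleft b\}$ and ${\vartriangleleft}^{\mathsf{Dec}} = \{(b,a) : a\le b,\ b \vartriangleleft a\}$. The weak order on posets is ${\vartriangleleft} \preccurlyeq {\blacktriangleleft}$ iff ${\vartriangleleft}^{\mathsf{Inc}} \supseteq {\blacktriangleleft}^{\mathsf{Inc}}$ and ${\vartriangleleft}^{\mathsf{Dec}} \subseteq {\blacktriangleleft}^{\mathsf{Dec}}$. A permutation $\sigma \in \mathfrak{S}(n)$ gives the total order $\vartriangleleft_\sigma$ with $u \vartriangleleft_\sigma v$ iff $\sigma^{-1}(u) \le \sigma^{-1}(v)$. The weak order on $\mathfrak{S}(n)$ is: $\sigma \preccurlyeq \tau$ iff every pair $a<b$ with $\sigma^{-1}(a)>\sigma^{-1}(b)$ also satisfies $\tau^{-1}(a)>\tau^{-1}(b)$; it is a lattice with meet $\wedge_{\mathfrak{S}}$ and join $\vee_{\mathfrak{S}}$. For $\sigma \preccurlyeq \sigma'$ let ${\vartriangleleft_{[\sigma,\sigma']}}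 = {\vartriangleleft_\sigma} \cap {\vartriangleleft_{\sigma'}}$, and $\mathsf{WOIP}(n) = \{{\vartriangleleft_{[\sigma,\sigma']}} : \sigma \preccurlyeq \sigma'\}$. Under $\preccurlyeq$, $\mathsf{WOIP}(n)$ is a lattice with ${\vartriangleleft_{[\sigma,\sigma']}} \wedge_{\mathsf{WOIP}} {\vartriangleleft_{[\tau,\tau']}} = {\vartriangleleft_{[\sigma \wedge_{\mathfrak{S}} \tau,\, \sigma' \wedge_{\mathfrak{S}} \tau']}}$ and ${\vartriangleleft_{[\sigma,\sigma']}} \vee_{\mathsf{WOIP}} {\vartriangleleft_{[\tau,\tau']}} = {\vartriangleleft_{[\sigma \vee_{\mathfrak{S}} \tau,\, \sigma' \vee_{\mathfrak{S}} \tau']}}$. A subset induces a sublattice if it is closed under this meet and join. An $\mathbb{O}$-permutree is a directed tree $T$ with nodes bijectively labeled by (and identified with) $[n]$ such that each node $v$ has two parent slots (left and right) if $v \in \mathbb{O}^+$ and one parent slot otherwise, and two child slots (left and right) if $v \in \mathbb{O}^-$ and one child slot otherwise; each slot is either empty or contains exactly one neighbor (parents are outgoing neighbors, children are incoming neighbors); and if $v$ has two parent (resp. child) slots, all labels in the left ancestor (resp. descendant) subtree of $v$ (the connected component of $T \smallsetminus v$ attached through the left slot) are smaller than $v$ and all labels in the right one are larger than $v$. Let $i \vartriangleleft_T j$ iff there is a directed path (possibly of length $0$) from $i$ to $j$ in $T$. Then $\mathsf{PEP}(\mathbb{O}) = \{{\vartriangleleft_T} : T \text{ an } \mathbb{O}\text{-permutree}\}$.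 *)

(* Defs.v *)
From mathcomp Require Import all_boot all_fingroup.

Set Implicit Arguments.
Unset Strict Implicit.
Unset Printing Implicit Defensive.

(* The label set [n] = {1, ..., n} is represented by 'I_n = {0, ..., n-1}.
   A relation on [n] is the set of the pairs it relates. *)
Definition label_rel n := {set 'I_n * 'I_n}.

Definition Inc n (P : label_rel n) : label_rel n :=
  [set p in P | p.1 <= p.2].

Definition Dec n (P : label_rel n) : label_rel n :=
  [set p in P | p.2 <= p.1].

Definition weak_le n (P Q : label_rel n) : Prop :=
  (Inc Q \subset Inc P) /\ (Dec P \subset Dec Q).

(* sigma : 'S_n sends positions to values, so sigma^-1 u is the position
   of u. *)
Definition perm_rel n (s : 'S_n) : label_rel n :=
  [set p : 'I_n * 'I_n | (s^-1)%g p.1 <= (s^-1)%g p.2].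

Definition perm_le n (s t : 'S_n) : Prop :=
  forall a b : 'I_n, a < b ->
    (s^-1)%g b < (s^-1)%g a -> (t^-1)%g b < (t^-1)%g a.

Definition interval_rel n (s s' : 'S_n) : label_rel n :=
  perm_rel s :&: perm_rel s'.

Definition WOIP n (P : label_rel n) : Prop :=
  exists s s' : 'S_n, perm_le s s' /\ P = interval_rel s s'.

Section Sublattice.
Variables (T : Type) (le : T -> T -> Prop) (L : T -> Prop).

Definition is_meet (x y m : T) : Prop :=
  [/\ L m, le m x, le m y & forall z, L z -> le z x -> le z y -> le z m].

Definition is_join (x y j : T) : Prop :=
  [/\ L j, le x j, le y j & forall z, L z -> le x z -> le y z -> le j z].

(* The meet and the join are those of the ambient (L, le), not those of
   (S, le). *)
Definition induces_sublattice (S : T -> Prop) : Prop :=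
  (forall x, S x -> L x) /\
  (forall x y, S x -> S y ->
    (exists2 m, is_meet x y m & S m) /\ (exists2 j, is_join x y j & S j)).

End Sublattice.

Record orientation (n : nat) := Orientation {
  Oplus : {set 'I_n};
  Ominus : {set 'I_n}
}.

(* A node has either the single slot Only, or the two slots Left and Right. *)
Inductive slot := Only | Left | Right.

Definition has_slot (two : bool) (s : slot) : Prop :=
  if two then s = Left \/ s = Right else s = Only.

(* edge v w means v -> w, i.e. w is a parent of v and v is a child of w;
   pslot v w (resp. cslot v w) is the slot of v that contains its parent
   (resp. child) w, and is irrelevant for other w. *)
Record slotted_digraph (n : nat) := SlottedDigraph {
  edge : rel 'I_n;
  pslot : 'I_n -> 'I_n -> slot;
  cslot : 'I_n -> 'I_n -> slot
}.

Section Permutree.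
Variables (n : nat) (O : orientation n) (T : slotted_digraph n).

Definition adj : rel 'I_n := [rel x y | edge T x y || edge T y x].

Definition is_directed_tree : Prop :=
  [/\ forall x, ~~ edge T x x,
      forall x y, edge T x y -> ~~ edge T y x,
      forall x y, connect adj x y
    & forall c : seq 'I_n, 2 < size c -> ~ ucycle adj c].

(* For a neighbor w of v: the connected component of w in T \ v. *)
Definition in_subtree (v w x : 'I_n) : bool :=
  connect [rel y z | [&& y != v, z != v & adj y z]] w x.

Definition is_permutree : Prop :=
  [/\ is_directed_tree,
      (forall v w, edge T v w -> has_slot (v \in Oplus O) (pslot T v w)) /\
      (forall v w, edge T w v -> has_slot (v \in Ominus O) (cslot T v w)),
      (forall v w w', edge T v w -> edge T v w' ->
         pslot T v w = pslot T v w' -> w = w') /\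
      (forall v w w', edge T w v -> edge T w' v ->
         cslot T v w = cslot T v w' -> w = w'),
      forall v w x, v \in Oplus O -> edge T v w -> in_subtree v w x ->
        (pslot T v w = Left -> x < v) /\ (pslot T v w = Right -> v < x)
    & forall v w x, v \in Ominus O -> edge T w v -> in_subtree v w x ->
        (cslot T v w = Left -> x < v) /\ (cslot T v w = Right -> v < x)].

Definition tree_rel : label_rel n :=
  [set p : 'I_n * 'I_n | connect (edge T) p.1 p.2].

End Permutree.

Definition PEP n (O : orientation n) (P : label_rel n) : Prop :=
  exists T : slotted_digraph n, is_permutree O T /\ P = tree_rel T.

(* Compatibility of is_meet and is_join with the formulas for the meet and
   the join of weak order interval posets in terms of those of the weak order
   on permutations. *)

Lemma weak_le_anti n (P Q : label_rel n) : weak_le P Q -> weak_le Q P -> P = Q.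
Proof.
move=> [iQP dPQ] [iPQ dQP]; apply/setP=> -[a b].
have/setP/(_ (a, b)) : Inc P = Inc Q by apply/eqP; rewrite eqEsubset iPQ.
have/setP/(_ (a, b)) : Dec P = Dec Q by apply/eqP; rewrite eqEsubset dPQ.
by rewrite !inE /=; case: (leqP a b) => [_ _|/ltnW->]; rewrite !andbT.
Qed.

Lemma Inc_interval n (s s' : 'S_n) (a b : 'I_n) : perm_le s s' -> a < b ->
  ((a, b) \in Inc (interval_rel s s')) = ((s'^-1)%g a < (s'^-1)%g b).
Proof.
move=> ss' ab; have nab : a != b by rewrite -val_eqE /= ltn_eqF.
have ne : val ((s'^-1)%g a) != (s'^-1)%g b.
  by rewrite (inj_eq val_inj) (inj_eq perm_inj).
rewrite !inE /= (ltnW ab) andbT [RHS]ltn_neqAle ne /=.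
case: (leqP ((s'^-1)%g a) _) => [le|]; last by rewrite andbF.
by rewrite andbT leqNgt; apply/negP=> /(ss' _ _ ab); rewrite ltnNge le.
Qed.

Lemma Dec_interval n (s s' : 'S_n) (a b : 'I_n) : perm_le s s' -> a < b ->
  ((b, a) \in Dec (interval_rel s s')) = ((s^-1)%g b < (s^-1)%g a).
Proof.
move=> ss' ab; have nab : b != a by rewrite -val_eqE /= gtn_eqF.
have ne : val ((s^-1)%g b) != (s^-1)%g a.
  by rewrite (inj_eq val_inj) (inj_eq perm_inj).
rewrite !inE /= (ltnW ab) andbT [RHS]ltn_neqAle ne /=.
case: (leqP ((s^-1)%g b) _) => //= le.
by apply/ltnW/ss'; rewrite // ltn_neqAle ne.
Qed.

Lemma weak_le_interval n (s s' t t' : 'S_n) : perm_le s s' -> perm_le t t' ->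
  weak_le (interval_rel s s') (interval_rel t t') <->
  perm_le s t /\ perm_le s' t'.
Proof.
move=> ss' tt'.
have ltP (u : 'S_n) (a b : 'I_n) : a < b ->
    ((u^-1)%g a < (u^-1)%g b) = ~~ ((u^-1)%g b < (u^-1)%g a).
  move=> ab; have nab : a != b by rewrite -val_eqE /= ltn_eqF.
  by rewrite -leqNgt ltn_neqAle (inj_eq val_inj) (inj_eq perm_inj) nab.
split=> [[/subsetP iP /subsetP dP]|[st st']].
  split=> a b ab.
    by have := dP (b, a); rewrite !Dec_interval.
  have := iP (a, b); rewrite !Inc_interval // (ltP t') // (ltP s') // => h.
  by apply: contraLR.
split; apply/subsetP=> -[a b] h.
  have: a <= b by have := h; rewrite inE => /andP[].
  rewrite leq_eqVlt => /orP[/eqP/val_inj->|ab]; first by rewrite !inE /= !leqnn.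
  move: h; rewrite !Inc_interval // (ltP t') // (ltP s') //.
  by apply: contra; apply: st'.
have: b <= a by have := h; rewrite inE => /andP[].
rewrite leq_eqVlt => /orP[/eqP/val_inj->|ab]; first by rewrite !inE /= !leqnn.
by move: h; rewrite !Dec_interval //; apply: st.
Qed.

Lemma perm_le_trans n (s t u : 'S_n) :
  perm_le s t -> perm_le t u -> perm_le s u.
Proof. by move=> st tu a b ab /(st _ _ ab)/(tu _ _ ab). Qed.

Lemma interval_meet n (s s' t t' m m' : 'S_n) :
  perm_le s s' -> perm_le t t' ->
  is_meet (@perm_le n) (fun _ => True) s t m ->
  is_meet (@perm_le n) (fun _ => True) s' t' m' ->
  is_meet (@weak_le n) (@WOIP n)
    (interval_rel s s') (interval_rel t t') (interval_rel m m').
Proof.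
move=> ss' tt' [_ ms mt mP] [_ ms' mt' mP'].
have mm' : perm_le m m'.
  by apply: mP' => //; [apply: perm_le_trans ss'|apply: perm_le_trans tt'].
split; first by exists m, m'.
- exact/weak_le_interval.
- exact/weak_le_interval.
move=> _ [z [z' [zz' ->]]] /(weak_le_interval zz' ss')[zs zs'].
move=> /(weak_le_interval zz' tt')[zt zt'].
by apply/weak_le_interval => //; split; [apply: mP|apply: mP'].
Qed.

Lemma interval_join n (s s' t t' j j' : 'S_n) :
  perm_le s s' -> perm_le t t' ->
  is_join (@perm_le n) (fun _ => True) s t j ->
  is_join (@perm_le n) (fun _ => True) s' t' j' ->
  is_join (@weak_le n) (@WOIP n)
    (interval_rel s s') (interval_rel t t') (interval_rel j j').
Proof.
move=> ss' tt' [_ sj tj jP] [_ sj' tj' jP'].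
have jj' : perm_le j j'.
  by apply: jP => //; [apply: perm_le_trans sj'|apply: perm_le_trans tj'].
split; first by exists j, j'.
- exact/weak_le_interval.
- exact/weak_le_interval.
move=> _ [z [z' [zz' ->]]] /(weak_le_interval ss' zz')[sz sz'].
move=> /(weak_le_interval tt' zz')[tz tz'].
by apply/weak_le_interval => //; split; [apply: jP|apply: jP'].
Qed.

(* Main.v *)
Require Import Defs.
From mathcomp Require Import all_boot all_fingroup.

Set Implicit Arguments.
Unset Strict Implicit.
Unset Printing Implicit Defensive.

(** A poset [r] is a permutree element poset if and only if
    - for [b] in O- strictly between [x] and [y], [r x y] implies [r b y];
    - for [b] in O+ strictly between [x] and [y], [r x y] implies [r x b];
    - for incomparable [x] and [y], some [b] strictly between them satisfies
      [b] in O- and [r x b], or [b] in O+ and [r b x].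
    From a tree to these conditions, [b] is the first turn of the path from
    [x] to [y]; conversely the tree is the Hasse diagram of the poset.

    The meet of [P] and [Q] in WOIP has for increasing part the transitive
    closure of the union of the increasing parts, and for non-decreasing part
    the transitive closure of the union of the complements of the decreasing
    parts; the three conditions pass to these closures.  Joins follow by
    reversing the relations, which exchanges O+ and O-. *)

(** * Interval posets, biclosed sets and permutations *)

Definition between n (b x y : 'I_n) : bool := (x < b < y) || (y < b < x).

Definition rel_of n (P : label_rel n) : rel 'I_n := fun x y => (x, y) \in P.

Definition interval_poset n (r : rel 'I_n) : Prop :=
  [/\ reflexive r, antisymmetric r, transitive r
    & forall x b y, between b x y -> r x y -> r x b || r b y].

(** The closure properties that characterise inversion sets of permutations; only the pairs with
    [a < b] matter. *)
Definition biclosed n (D : rel 'I_n) : Prop :=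
  forall a b c : 'I_n, a < b -> b < c ->
    (D a b -> D b c -> D a c) /\ (D a c -> D a b || D b c).

(** Reversing exactly the pairs of [D] in the natural order gives a strict total order [l], and the
    position of [x] is the number of elements that precede it in [l]. *)
Lemma perm_of_biclosed n (D : rel 'I_n) : biclosed D ->
  exists s : 'S_n, forall a b : 'I_n, a < b ->
    ((s^-1)%g b < (s^-1)%g a) = D a b.
Proof.
move=> bD; pose l (x y : 'I_n) := if x < y then ~~ D x y else (y < x) && D y x.
have lxx x : l x x = false by rewrite /l ltnn.
have ltot x y : x != y -> l x y || l y x.
  rewrite -val_eqE /l /=; case: (ltngtP x y) => //= _ _; first by case: (D x y).
  by case: (D y x).
have ltr y x z : l x y -> l y z -> l x z.
  rewrite /l; case: (ltngtP x y) => [xy|yx|//]; case: (ltngtP y z) => [yz|zy|//] /=.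
  - rewrite (ltn_trans xy yz); have [_ h] := bD _ _ _ xy yz.
    by move=> p q; apply/negP=> /h; rewrite (negPf p) (negPf q).
  - case: (ltngtP x z) => [xz|zx|xz] /= Dxy Dzy; last by rewrite (val_inj xz) Dzy in Dxy.
      by apply: contra Dxy => Dxz; have [->] := bD _ _ _ xz zy.
    have [_ h] := bD _ _ _ zx xy.
    by move: (h Dzy); rewrite (negPf Dxy) orbF.
  - case: (ltngtP x z) => [xz|zx|xz] /= Dyx Dyz; last by rewrite -(val_inj xz) Dyx in Dyz.
      by apply: contra Dyz => Dxz; have [->] := bD _ _ _ yx xz.
    have [_ h] := bD _ _ _ yz zx.
    by move: (h Dyx); rewrite (negPf Dyz).
  - rewrite (ltn_trans zy yx) ltnNge (ltnW (ltn_trans zy yx)) /= => Dyx Dzy.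
    by have [->] := bD _ _ _ zy yx.
have rlt x : #|[set y | l y x]| < n.
  have := @proper_card _ [set y | l y x] [set: 'I_n].
  rewrite cardsT card_ord; apply; rewrite properE subsetT.
  by apply/subsetPn; exists x; rewrite !inE ?lxx.
pose rk x := Ordinal (rlt x).
have rkP x y : l x y -> rk x < rk y.
  move=> lxy; apply: proper_card; rewrite properE; apply/andP; split.
    by apply/subsetP => z; rewrite !inE => /ltr; apply.
  by apply/subsetPn; exists x; rewrite !inE ?lxx.
have rkI : injective rk.
  move=> x y e; apply/eqP/negPn/negP => /ltot /orP[] /rkP;
  by rewrite e ltnn.
exists ((perm rkI)^-1)%g => a b ab; rewrite invgK !permE.
case Dab: (D a b); first by apply: rkP; rewrite /l ltnNge ltnW //= ab.
by apply/negbTE; rewrite -leqNgt ltnW //; apply: rkP; rewrite /l ab Dab.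
Qed.

(** The complements of [I] and [N] are biclosed as well, hence are the inversion sets of the upper
    end [s'] and of the lower end [s] of an interval. *)
Lemma WOIP_of_biclosed n (I N : rel 'I_n) : biclosed I -> biclosed N ->
  (forall a b : 'I_n, a < b -> I a b -> N a b) ->
  exists2 P : label_rel n, WOIP P
    & forall a b : 'I_n, a < b ->
        (rel_of P a b = I a b) /\ (rel_of P b a = ~~ N a b).
Proof.
have bC (D : rel 'I_n) : biclosed D -> biclosed (fun a b => ~~ D a b).
  move=> bD a b c ab bc; have [h1 h2] := bD _ _ _ ab bc; split.
    by move=> p q; apply/negP => /h2; rewrite (negPf p) (negPf q).
  by rewrite -negb_and; apply: contra => /andP[p q]; apply: h1.
move=> /bC/perm_of_biclosed[s' hs'] /bC/perm_of_biclosed[s hs] IN.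
have ss' : perm_le s s'.
  by move=> a b ab; rewrite hs // hs' //; apply: contra; apply: IN.
exists (interval_rel s s'); first by exists s, s'.
move=> a b ab; split.
  have := Inc_interval ss' ab; rewrite inE /= ltnW // andbT /rel_of => ->.
  rewrite ltn_neqAle leqNgt hs' // negbK (inj_eq val_inj) (inj_eq perm_inj).
  by rewrite -val_eqE /= ltn_eqF.
by have := Dec_interval ss' ab; rewrite inE /= ltnW // andbT /rel_of => ->; rewrite hs.
Qed.

(** For the converse, the increasing pairs of an interval poset and the complement of its decreasing
    pairs are biclosed: transitivity gives one half of each condition and the betweenness axiom the
    other. *)
Lemma WOIP_interval_poset n (P : label_rel n) :
  WOIP P <-> interval_poset (rel_of P).
Proof.
split=> [[s [s' [ss' ->]]]|[rr ra rt rw]].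
  have inc (x y : 'I_n) : x < y -> rel_of (interval_rel s s') x y = ((s'^-1)%g x < (s'^-1)%g y).
    by move=> xy; rewrite -(Inc_interval ss' xy) inE /= ltnW // andbT.
  have dec (x y : 'I_n) : x < y -> rel_of (interval_rel s s') y x = ((s^-1)%g y < (s^-1)%g x).
    by move=> xy; rewrite -(Dec_interval ss' xy) inE /= ltnW // andbT.
  split.
  - by move=> x; rewrite /rel_of !inE !leqnn.
  - move=> x y; rewrite /rel_of !inE /= => /andP[/andP[h _] /andP[h' _]].
    by apply/(@perm_inj _ s^-1%g)/val_inj/anti_leq; rewrite h.
  - move=> y x z; rewrite /rel_of !inE /= => /andP[h1 h2] /andP[h3 h4].
    by rewrite (leq_trans h1 h3) (leq_trans h2 h4).
  - move=> x b y /orP[] /andP[h1 h2].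
      rewrite !inc ?(ltn_trans h1 h2) // => h.
      by case: ltnP => //= h'; apply: leq_ltn_trans h.
    rewrite !dec ?(ltn_trans h1 h2) // => h.
    by case: ltnP => //= h'; apply: leq_ltn_trans h.
have [| |a b ab h|Q wQ hQ] :=
    @WOIP_of_biclosed n (rel_of P) (fun a b => ~~ rel_of P b a).
- move=> a b c ab bc; split; first exact: rt.
  by apply: rw; rewrite /between ab bc.
- move=> a b c ab bc; split; last first.
    by rewrite -negb_and; apply: contra => /andP[p q]; apply: rt q p.
  move=> p q; apply/negP => /(rw c b a); rewrite /between ab bc orbT.
  by rewrite (negPf p) (negPf q) => /(_ isT).
- apply/negP => h'; have e : a = b by apply: ra; rewrite h h'.
  by rewrite e ltnn in ab.
suff -> : P = Q by [].
apply/setP => -[x y]; rewrite -!/(rel_of _ x y).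
case: (ltngtP x y) => [xy|xy|/val_inj->].
- by case: (hQ _ _ xy).
- by case: (hQ _ _ xy) => _; rewrite negbK.
have [s [s' [_ ->]]] := wQ; have := rr y; rewrite /rel_of => ->.
by rewrite !inE !leqnn.
Qed.

(** * Local conditions for permutree element posets *)

Definition turn n (O : orientation n) (r : rel 'I_n) (x b : 'I_n) : bool :=
  (b \in Ominus O) && r x b || (b \in Oplus O) && r b x.

Definition permutree_poset n (O : orientation n) (r : rel 'I_n) : Prop :=
  [/\ [/\ reflexive r, antisymmetric r & transitive r],
      forall b x y, b \in Ominus O -> between b x y -> r x y -> r b y,
      forall b x y, b \in Oplus O -> between b x y -> r x y -> r x b
    & forall x y, ~~ r x y -> ~~ r y x ->
        exists2 b, between b x y & turn O r x b].

Lemma betweenC n (b x y : 'I_n) : between b x y = between b y x.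
Proof. by rewrite /between orbC. Qed.

Lemma between_trans n (b d x y : 'I_n) :
  between b x y -> between d x b -> between d x y.
Proof.
case/orP=> /andP[h1 h2]; case/orP=> /andP[h3 h4].
- by rewrite /between h3 (ltn_trans h4 h2).
- by have := ltn_trans (ltn_trans h3 h4) h1; rewrite ltnn.
- by have := ltn_trans (ltn_trans h3 h4) h2; rewrite ltnn.
- by rewrite /between h4 (ltn_trans h1 h3) orbT.
Qed.

(** If [b] violated the betweenness axiom for [r x y], it would be incomparable to [x]. A turn [d]
    from [b] towards [x] also lies between [x] and [y], so its condition yields [r d y] or [r x d],
    hence [r b y] or [r x b]. *)
Lemma permutree_poset_interval n (O : orientation n) (r : rel 'I_n) :
  permutree_poset O r -> interval_poset r.
Proof.
case=> [[rr ra rt] rm rp rc]; split=> // x b y xby xy; apply/norP=> -[xb b_y].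
have bx : ~~ r b x by apply: contra b_y => bx; apply: rt bx xy.
have [d] := rc _ _ bx xb; rewrite betweenC => dxb.
have dxy := between_trans xby dxb.
case/orP=> /andP[Od h].
  by case/negP: b_y; apply: rt h _; apply: rm Od dxy xy.
by case/negP: xb; apply: rt h; apply: rp Od dxy xy.
Qed.

(** For [y < x], take a turn [b] from [y] towards [x]. If [b] is comparable to [x], it is also a
    turn from [x]; otherwise [x] and [b] form a closer incomparable pair, and a turn for them also
    serves [x] and [y]. *)
Lemma incomparable_turns n (O : orientation n) (r : rel 'I_n) :
  reflexive r -> transitive r ->
  (forall x y : 'I_n, x < y -> ~~ r x y -> ~~ r y x ->
     exists2 b, between b x y & turn O r x b) ->
  forall x y, ~~ r x y -> ~~ r y x -> exists2 b, between b x y & turn O r x b.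
Proof.
move=> rr rt rlt x y nxy nyx; case: (ltngtP x y) => [xy|yx|/val_inj xy].
- exact: rlt.
- have [m] := ubnP (x - y); elim: m => // m IH in x y nxy nyx yx *.
  rewrite ltnS => xym.
  have [b yb tb] := rlt _ _ yx nyx nxy.
  have /andP[y_b bx] : y < b < x.
    by case/orP: yb => // /andP[h1 h2]; have := ltn_trans (ltn_trans h1 h2) yx; rewrite ltnn.
  have [bxc|nbx] := boolP (r b x).
    exists b; first by rewrite betweenC.
    case/orP: tb => /andP[Ob h]; first by rewrite (rt _ _ _ h bxc) in nyx.
    by rewrite /turn Ob bxc orbT.
  have [xbc|nxb] := boolP (r x b).
    exists b; first by rewrite betweenC.
    case/orP: tb => /andP[Ob h]; last by rewrite (rt _ _ _ xbc h) in nxy.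
    by rewrite /turn Ob xbc.
  have [//|//|//||d dxb td] := IH x b.
    by apply: leq_trans xym; rewrite ltn_sub2l // (ltn_trans y_b).
  by exists d => //; apply: between_trans dxb; rewrite betweenC.
by rewrite xy rr in nxy.
Qed.

(** * Transitive closures of increasing relations *)

Section IncreasingConnect.
Variables (n : nat) (e : rel 'I_n).
Hypothesis e_inc : forall x y, e x y -> x < y.

Lemma connect_inc_leq x y : connect e x y -> x <= y.
Proof.
case/connectP=> p + ->; elim: p x => //= z p IH x /andP[/e_inc/ltnW xz /IH].
exact: leq_trans.
Qed.

(** Labels increase along the path, so it either visits [b] or jumps over it in a single step. *)
Lemma connect_crossing (a b c : 'I_n) : a <= b <= c -> connect e a c ->
  (connect e a b /\ connect e b c) \/
  exists u v : 'I_n, [/\ u < b, b < v, connect e a u, e u v & connect e v c].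
Proof.
move=> abc /connectP[p ep ec]; elim: p a abc ep ec => [|x p IH] a /= /andP[ab bc].
  move=> _ ec; left; have -> : b = a by apply/val_inj/anti_leq; rewrite ab -ec bc.
  by rewrite ec !connect0.
case/andP=> eax exp ec.
have xc : connect e x c by apply/connectP; exists p.
case: (leqP x b) => [xb|bx].
  have [||//|[h1 h2]|[u [v [h1 h2 h3 h4 h5]]]] := IH x; first by rewrite xb bc.
  - by [].
  - by left; split=> //; apply: connect_trans h1; apply: connect1.
  by right; exists u, v; split=> //; apply: connect_trans h3; apply: connect1.
move: ab; rewrite leq_eqVlt => /orP[/eqP/val_inj <-|ab].
  by left; split=> //; apply: connect_trans xc; apply: connect1.
by right; exists a, x; split.
Qed.

(** When a path from [a] to [c] jumps over [b], the hypothesis cuts the jumping step at [b]. *)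
Lemma biclosed_connect :
  (forall a b c : 'I_n, a < b -> b < c -> e a c -> e a b || e b c) ->
  biclosed (connect e).
Proof.
move=> ec a b c ab bc; split; first exact: connect_trans.
case/(@connect_crossing a b c); first by rewrite (ltnW ab) (ltnW bc).
  by case=> ->.
move=> [u [v [ub bv au uv vc]]]; case/orP: (ec _ _ _ ub bv uv) => h.
  by rewrite (connect_trans au (connect1 h)).
by rewrite (connect_trans (connect1 h) vc) orbT.
Qed.

Lemma connect_last a b : connect e a b -> a != b ->
  exists2 u, connect e a u & e u b.
Proof.
case/connectP=> p; case/lastP: p => [_ ->|p x]; first by rewrite eqxx.
rewrite rcons_path last_rcons => /andP[ep ex] -> _.
by exists (last a p) => //; apply/connectP; exists p.
Qed.

Lemma connect_first a b : connect e a b -> a != b ->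
  exists2 u, e a u & connect e u b.
Proof.
case/connectP=> -[_ ->|x p]; first by rewrite eqxx.
by move=> /= /andP[ex ep] -> _; exists x => //; apply/connectP; exists p.
Qed.

End IncreasingConnect.

Lemma weak_leP n (P Q : label_rel n) :
  reflexive (rel_of P) -> reflexive (rel_of Q) ->
  weak_le P Q <-> forall a b : 'I_n, a < b ->
    (rel_of Q a b -> rel_of P a b) /\ (rel_of P b a -> rel_of Q b a).
Proof.
move=> rP rQ; split=> [[/subsetP h1 /subsetP h2] a b ab|h].
  split=> h.
    by have := h1 (a, b); rewrite !inE /= ltnW // !andbT; apply.
  by have := h2 (b, a); rewrite !inE /= ltnW // !andbT; apply.
split; apply/subsetP=> -[a b]; rewrite !inE /= => /andP[ab le].
  rewrite le andbT; case: (ltngtP a b) le => [lt|//|/val_inj e] _.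
    by have [h' _] := h _ _ lt; apply: h'.
  by rewrite e; apply: rP.
rewrite le andbT; case: (ltngtP a b) le => [//|lt|/val_inj e] _.
  by have [_ h'] := h _ _ lt; apply: h'.
by rewrite e; apply: rQ.
Qed.

(** * The meet of two permutree posets *)

Section Meet.
Variables (n : nat) (O : orientation n) (P Q : label_rel n).
Hypotheses (ppP : permutree_poset O (rel_of P)).
Hypotheses (ppQ : permutree_poset O (rel_of Q)).

Local Notation p := (rel_of P).
Local Notation q := (rel_of Q).

(* The steps generating the increasing and the non-decreasing pairs. *)
Let eI : rel 'I_n := fun x y => (x < y) && (p x y || q x y).
Let eN : rel 'I_n := fun x y => (x < y) && ~~ (p y x && q y x).

Let eI_inc x y : eI x y -> x < y. Proof. by case/andP. Qed.
Let eN_inc x y : eN x y -> x < y. Proof. by case/andP. Qed.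

Let betw (a b c : 'I_n) : a < b -> b < c -> between b a c.
Proof. by move=> h h'; rewrite /between h h'. Qed.
Let betw' (a b c : 'I_n) : a < b -> b < c -> between b c a.
Proof. by move=> h h'; rewrite /between h h' orbT. Qed.

Let asym r : permutree_poset O r -> forall x y : 'I_n, x < y -> r x y -> ~~ r y x.
Proof.
case=> [[_ ra _] _ _ _] x y xy h; apply/negP=> h'.
have e : x = y by apply: ra; rewrite h.
by rewrite e ltnn in xy.
Qed.

Let biI : biclosed (connect eI).
Proof.
apply: biclosed_connect => // a b c ab bc.
have [_ _ _ wp] := permutree_poset_interval ppP.
have [_ _ _ wq] := permutree_poset_interval ppQ.
rewrite /eI ab bc (ltn_trans ab bc) /= => /orP[] /[dup] h.
  by case/(wp _ _ _ (betw ab bc))/orP => ->; rewrite ?orbT.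
by case/(wq _ _ _ (betw ab bc))/orP => ->; rewrite ?orbT.
Qed.

(** By contraposition, cutting a step of [eN] at an intermediate label is the transitivity of [p]
    and [q]. *)
Let biN : biclosed (connect eN).
Proof.
apply: biclosed_connect => // a b c ab bc.
have [[_ _ tp] _ _ _] := ppP; have [[_ _ tq] _ _ _] := ppQ.
rewrite /eN ab bc (ltn_trans ab bc) /= -negb_and; apply: contra.
case/andP=> /andP[h1 h2] /andP[h3 h4].
by rewrite (tp _ _ _ h3 h1) (tq _ _ _ h4 h2).
Qed.

Let IN a b : connect eI a b -> connect eN a b.
Proof.
apply: connect_sub => x y /andP[xy h]; apply: connect1; rewrite /eN xy negb_and.
by case/orP: h => h; rewrite (asym _ xy h) ?orbT.
Qed.

(* If no turn exists strictly between a and c, take the largest y reachable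
   from a by increasing relations with (y, c) a step of eN: a turn of P or Q
   from y towards c would be a turn for the meet or a larger such y, so y is
   below c in P or Q. *)
Lemma meet_turn (m : rel 'I_n) :
  (forall a b : 'I_n, a < b ->
     (m a b = connect eI a b) /\ (m b a = ~~ connect eN a b)) ->
  forall a c : 'I_n, a < c -> connect eN a c ->
    connect eI a c \/ exists2 b : 'I_n, a < b < c & turn O m a b.
Proof.
move=> hm a c; have [k] := ubnP (val c); elim: k => // k IH in c *.
rewrite ltnS => ck ac Nac.
have [/existsP[b /andP[h1 h2]]|/existsPn ng] :=
  boolP [exists b : 'I_n, (a < b < c) && turn O m a b].
  by right; exists b.
left; pose Y (y : 'I_n) := connect eI a y && eN y c.
(* The last vertex before [c] on an [eN]-path qualifies: by induction it is reached from [a] by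
   increasing steps, since a turn before it is excluded. *)
have [y0 Yy0] : exists y, Y y.
  have [|u au uc] := connect_last Nac; first by rewrite -val_eqE /= ltn_eqF.
  exists u; rewrite /Y uc andbT.
  have := connect_inc_leq eN_inc au.
  rewrite leq_eqVlt => /orP[/eqP/val_inj<-|au']; first exact: connect0.
  have uc' := eN_inc uc.
  have [//|[b /andP[h1 h2] tb]] := IH u (leq_trans uc' ck) au' au.
  by have := ng b; rewrite h1 (ltn_trans h2) //= tb.
case: (@arg_maxnP _ y0 Y val Yy0) => y /andP[ay yc] ymax.
have yltc := eN_inc yc; have aley := connect_inc_leq eI_inc ay.
(* The argument is the same for [p] and [q]; it is applied to whichever of them does not put [c]
   below [y]. *)
have key r : permutree_poset O r -> (forall u v : 'I_n, u < v -> r u v -> eI u v) ->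
    (forall u v : 'I_n, u < v -> ~~ r v u -> eN u v) -> ~~ r c y -> connect eI a c.
  move=> [[rr ra rt] rm rp rc] rI rN ncy.
  have [yrc|nyc] := boolP (r y c).
    by apply: connect_trans ay (connect1 _); apply: rI.
  have [b yb tb] := rc _ _ nyc ncy.
  have {yb}/andP[yb bc] : y < b < c.
    by case/orP: yb => // /andP[h1 h2]; have := ltn_trans (ltn_trans h1 h2) yltc; rewrite ltnn.
  have ab := leq_ltn_trans aley yb; have [mab mba] := hm _ _ ab.
  have nb := ng b; rewrite ab bc /= in nb.
  case/orP: tb => /andP[Ob h].
    case/negP: nb; rewrite /turn Ob mab /=.
    by rewrite (connect_trans ay (connect1 (rI _ _ yb h))).
  have Nab : connect eN a b.
    by apply: contraNT nb; rewrite /turn Ob mba => ->; rewrite orbT.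
  have [Iab|[d /andP[h1 h2] td]] := IH b (leq_trans bc ck) ab Nab.
    have Yb : Y b.
      by rewrite /Y Iab; apply: rN => //; apply: contra ncy => h'; apply: rt h' h.
    by move: (ymax _ Yb); apply: contraLR => _; rewrite -ltnNge.
  by have := ng d; rewrite h1 (ltn_trans h2) //= td.
have := yc; rewrite /eN yltc negb_and => /orP[].
  apply: key => // u v uv h; first by rewrite /eI uv h.
  by rewrite /eN uv negb_and h.
apply: key => // u v uv h; first by rewrite /eI uv h orbT.
by rewrite /eN uv negb_and h orbT.
Qed.

Lemma permutree_poset_meet :
  exists2 M, is_meet (@weak_le n) (@WOIP n) P Q M & permutree_poset O (rel_of M).
Proof.
have [M wM hM] := WOIP_of_biclosed biI biN (fun a b _ => @IN a b).
have [mr ma mt mw] : interval_poset (rel_of M) by apply/WOIP_interval_poset.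
have [[pr pa pt] pm pp pc] := ppP; have [[qr qa qt] qm qp qc] := ppQ.
(* The conditions at [b] in terms of single steps: an increasing step over [b] can be cut to start
   or end at [b], and a non-decreasing step ending or starting at [b] can be prolonged beyond it. *)
have eIm (b u v : 'I_n) : b \in Ominus O -> u < b -> b < v -> eI u v -> eI b v.
  move=> Ob ub bv; rewrite /eI bv => /andP[_ /orP[h|h]].
    by rewrite (pm _ _ _ Ob (betw ub bv) h : p b v).
  by rewrite (qm _ _ _ Ob (betw ub bv) h : q b v) orbT.
have eIp (b u v : 'I_n) : b \in Oplus O -> u < b -> b < v -> eI u v -> eI u b.
  move=> Ob ub bv; rewrite /eI ub => /andP[_ /orP[h|h]].
    by rewrite (pp _ _ _ Ob (betw ub bv) h : p u b).
  by rewrite (qp _ _ _ Ob (betw ub bv) h : q u b) orbT.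
have eNm (b u v : 'I_n) : b \in Ominus O -> u < b -> b < v -> eN u b -> eN u v.
  move=> Ob ub bv; rewrite /eN (ltn_trans ub bv) => /andP[_]; apply: contra.
  case/andP=> /(pm _ _ _ Ob (betw' ub bv)) h /(qm _ _ _ Ob (betw' ub bv)) h'.
  by rewrite h h'.
have eNp (b u v : 'I_n) : b \in Oplus O -> u < b -> b < v -> eN b v -> eN u v.
  move=> Ob ub bv; rewrite /eN (ltn_trans ub bv) => /andP[_]; apply: contra.
  case/andP=> /(pp _ _ _ Ob (betw' ub bv)) h /(qp _ _ _ Ob (betw' ub bv)) h'.
  by rewrite h h'.
have neq (a b : 'I_n) : a < b -> a != b by move=> ab; rewrite -val_eqE /= ltn_eqF.
exists M; last first.
  split=> //.
  - move=> b x y Ob /orP[] /andP[h1 h2].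
      have [-> _] := hM _ _ (ltn_trans h1 h2); have [-> _] := hM _ _ h2.
      case/(@connect_crossing _ _ x b y); [by rewrite (ltnW h1) (ltnW h2)|by case|].
      move=> [u [v [ub bv xu uv vy]]]; apply: connect_trans vy.
      by apply: connect1; apply: eIm uv.
    (* For decreasing pairs, by contraposition: the last step of an [eN]-path from [y] to [b] is
       prolonged to [x]. *)
    have [_ ->] := hM _ _ (ltn_trans h1 h2); have [_ ->] := hM _ _ h1.
    apply: contra => Nyb; have [u yu ub] := connect_last Nyb (neq _ _ h1).
    apply: connect_trans yu (connect1 _).
    exact: eNm Ob (eN_inc ub) h2 ub.
  - move=> b x y Ob /orP[] /andP[h1 h2].
      have [-> _] := hM _ _ (ltn_trans h1 h2); have [-> _] := hM _ _ h1.
      case/(@connect_crossing _ _ x b y); [by rewrite (ltnW h1) (ltnW h2)|by case|].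
      move=> [u [v [ub bv xu uv vy]]]; apply: connect_trans xu _.
      by apply: connect1; apply: eIp uv.
    have [_ ->] := hM _ _ (ltn_trans h1 h2); have [_ ->] := hM _ _ h2.
    apply: contra => Nbx; have [u bu ux] := connect_first Nbx (neq _ _ h2).
    apply: connect_trans ux; apply: connect1.
    exact: eNp Ob h1 (eN_inc bu) bu.
  apply: incomparable_turns => // a c ac nac nca.
  have [mac mca] := hM _ _ ac.
  rewrite mca negbK in nca.
  have [|[b /andP[ab bc] tb]] := meet_turn hM ac nca; first by rewrite -mac (negPf nac).
  by exists b => //; apply: betw.
split=> //.
- apply/weak_leP => // a b ab; have [-> ->] := hM _ _ ab; split=> h.
    by apply: connect1; rewrite /eI ab h.
  by apply: contraR h => h; apply: connect1; rewrite /eN ab negb_and h.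
- apply/weak_leP => // a b ab; have [-> ->] := hM _ _ ab; split=> h.
    by apply: connect1; rewrite /eI ab h orbT.
  by apply: contraR h => h; apply: connect1; rewrite /eN ab negb_and h orbT.
move=> Z /WOIP_interval_poset[zr za zt zw].
move=> /(weak_leP zr pr) zP /(weak_leP zr qr) zQ.
apply/weak_leP => // a b ab; have [-> ->] := hM _ _ ab; split.
  case/connectP=> s + ->; elim: s a {ab} => //= x s IH a /andP[/andP[ax h] /IH].
  have [zp _] := zP _ _ ax; have [zq _] := zQ _ _ ax.
  by apply: zt; case/orP: h; [apply: zp | apply: zq].
(* The betweenness axiom of [Z] at the first vertex [x] of the path gives either [x] below [a],
   which contradicts the first step because [Z] lies under [P] and [Q], or [b] below [x], and the
   argument repeats on the rest of the path. *)
move=> zba; apply/negP=> /connectP[s es eb].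
elim: s a ab zba es eb => [|x s IH] a ab zba /= es eb.
  by rewrite eb ltnn in ab.
case/andP: es => /andP[ax nes] es.
have xb : x <= b by apply: (connect_inc_leq eN_inc); apply/connectP; exists s.
have [_ zp] := zP _ _ ax; have [_ zq] := zQ _ _ ax.
suff : rel_of Z x a by move=> h; case/negP: nes; rewrite (zp h) (zq h).
move: xb; rewrite leq_eqVlt => /orP[/eqP/val_inj->//|xb].
case/orP: (zw _ _ _ (betw' ax xb) zba) => // h.
by case: (IH x xb h).
Qed.

End Meet.

(** * Joins by reversal *)

Definition opp_orientation n (O : orientation n) : orientation n :=
  Orientation (Ominus O) (Oplus O).

Definition opp n (P : label_rel n) : label_rel n :=
  [set p : 'I_n * 'I_n | (p.2, p.1) \in P].

Lemma rel_of_opp n (P : label_rel n) x y : rel_of (opp P) x y = rel_of P y x.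
Proof. by rewrite /rel_of inE. Qed.

Lemma oppK n : involutive (@opp n).
Proof. by move=> P; apply/setP=> -[x y]; rewrite !inE. Qed.

Lemma permutree_poset_opp n (O : orientation n) (r : rel 'I_n) :
  permutree_poset O r -> permutree_poset (opp_orientation O) (fun x y => r y x).
Proof.
case=> [[rr ra rt] rm rp rc]; split.
- split=> //; first by move=> x y /andP[h h']; apply: ra; rewrite h h'.
  by move=> y x z h h'; apply: rt h' h.
- by move=> b x y Ob; rewrite betweenC; apply: rp.
- by move=> b x y Ob; rewrite betweenC; apply: rm.
- move=> x y nyx nxy; have [b h t] := rc _ _ nxy nyx.
  by exists b => //; rewrite /turn orbC.
Qed.

Lemma eq_permutree_poset n (O : orientation n) (r r' : rel 'I_n) : r =2 r' ->
  permutree_poset O r -> permutree_poset O r'.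
Proof.
move=> e [[rr ra rt] rm rp rc]; split.
- split.
  + by move=> x; rewrite -e.
  + by move=> x y; rewrite -!e; apply: ra.
  + by move=> y x z; rewrite -!e; apply: rt.
- by move=> b x y; rewrite -!e; apply: rm.
- by move=> b x y; rewrite -!e; apply: rp.
- move=> x y; rewrite -!e => h1 h2; have [b h t] := rc _ _ h1 h2.
  by exists b => //; rewrite /turn -!e.
Qed.

Lemma WOIP_opp n (P : label_rel n) : WOIP P -> WOIP (opp P).
Proof.
move/WOIP_interval_poset=> [rr ra rt rw]; apply/WOIP_interval_poset; split.
- by move=> x; rewrite rel_of_opp.
- by move=> x y; rewrite !rel_of_opp andbC; apply: ra.
- by move=> y x z; rewrite !rel_of_opp => h h'; apply: rt h' h.
- by move=> x b y; rewrite !rel_of_opp orbC betweenC; apply: rw.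
Qed.

(** Reversal exchanges increasing and decreasing pairs, hence turns meets into joins. *)
Lemma weak_le_opp n (P Q : label_rel n) : weak_le P Q -> weak_le (opp Q) (opp P).
Proof.
case=> /subsetP iQP /subsetP dPQ; split; apply/subsetP=> -[x y]; rewrite !inE /=.
  by have := dPQ (y, x); rewrite !inE.
by have := iQP (y, x); rewrite !inE.
Qed.

Lemma permutree_poset_join n (O : orientation n) (P Q : label_rel n) :
  permutree_poset O (rel_of P) -> permutree_poset O (rel_of Q) ->
  exists2 J, is_join (@weak_le n) (@WOIP n) P Q J & permutree_poset O (rel_of J).
Proof.
have ppo (O' : orientation n) R : permutree_poset O' (rel_of R) ->
    permutree_poset (opp_orientation O') (rel_of (opp R)).
  move/permutree_poset_opp; apply: eq_permutree_poset => x y.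
  by rewrite rel_of_opp.
move=> /ppo ppP /ppo ppQ.
have [M [wM MP MQ Mmax] ppM] := permutree_poset_meet ppP ppQ.
exists (opp M); last by move/ppo: ppM; case: (O).
split; first exact: WOIP_opp.
- by rewrite -[P]oppK; apply: weak_le_opp.
- by rewrite -[Q]oppK; apply: weak_le_opp.
move=> Z wZ PZ QZ; rewrite -[Z]oppK; apply: weak_le_opp.
by apply: Mmax; [apply: WOIP_opp|apply: weak_le_opp|apply: weak_le_opp].
Qed.

(** * Vertex deletion and Hasse diagrams *)

Definition avoid n (e : rel 'I_n) (v : 'I_n) : rel 'I_n :=
  [rel y z | [&& y != v, z != v & e y z]].

Lemma avoid_sym n (e : rel 'I_n) v : symmetric e -> symmetric (avoid e v).
Proof. by move=> es x y; rewrite /avoid /= es; case: (x != v); rewrite ?andbF. Qed.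

Lemma path_avoid n (e : rel 'I_n) v x p :
  path (avoid e v) x p -> x != v -> path e x p && (v \notin x :: p).
Proof.
elim: p x => [|y p IH] x /=; first by rewrite inE eq_sym => _ ->.
case/andP=> /and3P[_ yv xy] /IH /(_ yv) /andP[-> h] xv.
by rewrite xy inE eq_sym (negPf xv).
Qed.

Lemma avoid_path n (e : rel 'I_n) v x p :
  path e x p -> v \notin x :: p -> path (avoid e v) x p.
Proof.
elim: p x => //= y p IH x /andP[xy yp]; rewrite inE negb_or => /andP[vx vp].
rewrite (IH _ yp vp) /avoid /= xy !andbT eq_sym vx eq_sym.
by move: vp; rewrite inE negb_or => /andP[->].
Qed.

(** A simple path between two distinct neighbours of [v] that avoids [v] would close up through [v]
    to a cycle. *)
Lemma acyclic_neighbors n (e : rel 'I_n) v x y : symmetric e ->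
  (forall c : seq 'I_n, 2 < size c -> ~ ucycle e c) ->
  e v x -> e v y -> x != v -> connect (avoid e v) x y -> x = y.
Proof.
move=> es acy vx vy xv /connectP[p0 pp0 ey]; apply/eqP/negPn/negP => nxy.
case/shortenP: pp0 ey => p pp up _ ey.
have /andP[ep vp] := path_avoid pp xv.
apply: (acy (v :: x :: p)).
  by case: p ey {pp up ep vp} => // ey; rewrite ey eqxx in nxy.
apply/andP; split; last by rewrite cons_uniq vp.
by rewrite /= rcons_path vx ep -ey es.
Qed.

Section Hasse.
Variables (n : nat) (r : rel 'I_n).
Hypotheses (rr : reflexive r) (ra : antisymmetric r) (rt : transitive r).

Definition cover : rel 'I_n := fun x y =>
  [&& x != y, r x y & [forall z, r x z && r z y ==> (z == x) || (z == y)]].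

Lemma cover_rel x y : cover x y -> r x y. Proof. by case/and3P. Qed.

Lemma coverxx x : cover x x = false.
Proof. by rewrite /cover eqxx. Qed.

Lemma cover_mid x y z : cover x y -> r x z -> r z y -> z = x \/ z = y.
Proof.
case/and3P=> _ _ /forallP/(_ z)/implyP h h1 h2.
by have /orP[/eqP|/eqP] : (z == x) || (z == y); [apply: h; rewrite h1 | left | right].
Qed.

Lemma cover_asym x y : cover x y -> r y x -> False.
Proof. by move=> h h'; have := h; rewrite (ra (_ : r x y && r y x)) ?coverxx // h' cover_rel. Qed.

(** Induction on the size of the poset interval from [x] to [y]: if [y] does not cover [x], an
    intermediate [z] splits it into two smaller intervals. *)
Lemma connect_cover x y : connect cover x y = r x y.
Proof.
apply/idP/idP => [/connectP[p + ->]|].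
  elim: p x => [|z p IH] x /=; first by rewrite rr.
  by case/andP=> /cover_rel xz /IH; apply: rt.
have [m] := ubnP #|[set z | r x z && r z y]|; elim: m x y => // m IH x y.
rewrite ltnS => lm xy; have [->|nxy] := eqVneq x y; first exact: connect0.
have [cxy|] := boolP (cover x y); first exact: connect1.
rewrite /cover nxy xy /= => /forallPn[z]; rewrite negb_imply negb_or.
case/andP=> /andP[xz zy] /andP[zx z_y]; apply: (@connect_trans _ _ z); apply: IH => //.
  apply: leq_trans lm; apply: proper_card; rewrite properE; apply/andP; split.
    by apply/subsetP=> t; rewrite !inE => /andP[-> /rt]; apply.
  apply/subsetPn; exists y; rewrite !inE ?rr ?xy //.
  by apply: contra z_y => /andP[_ h]; apply/eqP/ra; rewrite zy h.
apply: leq_trans lm; apply: proper_card; rewrite properE; apply/andP; split.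
  by apply/subsetP=> t; rewrite !inE => /andP[/(rt xz) -> ->].
apply/subsetPn; exists x; rewrite !inE ?rr ?xy //.
by apply: contra zx => /andP[h _]; apply/eqP/ra; rewrite xz h.
Qed.

End Hasse.

(** * The Hasse diagram of a permutree poset is a permutree *)

Section HasseTree.
Variables (n : nat) (O : orientation n) (r : rel 'I_n).
Hypothesis ppr : permutree_poset O r.

Let rr : reflexive r. Proof. by case: ppr => [[]]. Qed.
Let ra : antisymmetric r. Proof. by case: ppr => [[]]. Qed.
Let rt : transitive r. Proof. by case: ppr => [[]]. Qed.

Definition hasse_adj : rel 'I_n := [rel x y | cover r x y || cover r y x].

Lemma hasse_adj_sym : symmetric hasse_adj.
Proof. by move=> x y; rewrite /hasse_adj /= orbC. Qed.

(** The two children are incomparable, so there is a turn [b] from [w] towards [w']. No turn from a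
    child of [v] lies strictly between that child and [v]. Hence [b] is [v], or it lies between [w']
    and [v], where [b] itself or a turn from [w'] towards [b] is excluded in the same way. *)
Lemma children_separated w w' v : cover r w v -> cover r w' v -> w != w' ->
  v \in Ominus O /\ between v w w'.
Proof.
move=> cwv cwv' nww; have [_ rm rp rc] := ppr.
have step x b : cover r x v -> turn O r x b -> between b x v -> False.
  move=> cxv tb bxv; have [bx bv] : b <> x /\ b <> v.
    by split=> e; move: bxv; rewrite e /between !ltnn ?andbF.
  case/orP: tb => /andP[Ob h].
    have h' := rm _ _ _ Ob bxv (cover_rel cxv).
    by case: (cover_mid cxv h h').
  have h' := rp _ _ _ Ob bxv (cover_rel cxv).
  by apply: bx; apply: ra; rewrite h h'.
have inc x y : cover r x v -> cover r y v -> x != y -> ~~ r x y.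
  move=> cx cy nxy; apply/negP => h.
  have [e|e] := cover_mid cx h (cover_rel cy); first by rewrite e eqxx in nxy.
  by rewrite e coverxx in cy.
have iw := inc _ _ cwv cwv' nww.
have iw' : ~~ r w' w by apply: inc => //; rewrite eq_sym.
have [b bww tb] := rc _ _ iw iw'.
have [e|nbv] := eqVneq b v.
  move: tb bww; rewrite e => /orP[] /andP[Ov h] // _.
  by case: (cover_asym ra cwv h).
have bwv' : between b w' v.
  have : ~~ between b w v by apply/negP => /(step _ _ cwv tb).
  move: bww nbv; rewrite -val_eqE /= /between.
  by case: (ltngtP b v); case: (ltngtP b w); case: (ltngtP b w').
have [c1|n1] := boolP (r w' b).
  case/orP: tb => /andP[Ob h]; last by rewrite (rt c1 h) in iw'.
  by case: (step w' b) => //; rewrite /turn Ob c1.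
have [c2|n2] := boolP (r b w').
  case/orP: tb => /andP[Ob h]; first by rewrite (rt h c2) in iw.
  by case: (step w' b) => //; rewrite /turn Ob c2 orbT.
have [d dwb td] := rc _ _ n1 n2.
by case: (step w' d) => //; apply: between_trans dwb.
Qed.

(** Some edge of the path has its ends on both sides of [v], and the condition at [v] puts the upper
    end of that edge above [v]. *)
Lemma crossing_above v x p : v \in Ominus O -> path hasse_adj x p ->
  v \notin x :: p -> between v x (last x p) -> has (r v) (x :: p).
Proof.
move=> Ov; have [_ rm _ _] := ppr.
elim: p x => [|y p IH] x /=.
  by rewrite /between orbb => _ _ /andP[/ltn_trans h /h]; rewrite ltnn.
case/andP=> xy yp; rewrite inE negb_or => /andP[vx vp] bv.
have [bxy|nbxy] := boolP (between v x y).
  case/orP: xy => /cover_rel xy; first by rewrite (rm v x y) ?orbT.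
  by rewrite (rm v y x) // betweenC.
apply/orP; right; apply: IH => //; move: vp bv nbxy vx; rewrite inE negb_or -!val_eqE /between /=.
by case: (ltngtP v x); case: (ltngtP v y); rewrite ?andbF ?orbF ?andbT.
Qed.

(* A maximal element u of a cycle has two children in it, on both sides of u;
   the rest of the cycle has to cross u, hence meets an element above u. *)
Lemma hasse_acyclic (c : seq 'I_n) : 2 < size c -> ~ ucycle hasse_adj c.
Proof.
move=> sc uc; have [u0 u0c] : exists u, u \in c.
  by case: c sc {uc} => // u c _; exists u; rewrite mem_head.
pose up u := #|[set z | r u z]|.
case: (@arg_minnP _ u0 (fun u => u \in c) up u0c) => u u_c umin.
have {umin} umax z : z \in c -> r u z -> z = u.
  move=> zc uz; apply/eqP/negPn/negP => nzu.
  have := umin _ zc; rewrite leqNgt => /negP[]; apply: proper_card.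
  rewrite properE; apply/andP; split.
    by apply/subsetP=> t; rewrite !inE; apply: rt.
  apply/subsetPn; exists u; rewrite !inE ?rr //.
  by apply: contra nzu => h; apply/eqP/ra; rewrite uz h.
have [i c' ec] := rot_to u_c.
have memc z : z \in u :: c' -> z \in c by rewrite -ec mem_rot.
move: uc; rewrite -(rot_ucycle i) ec => /andP[].
have : 2 < size (u :: c') by rewrite -ec size_rot.
case: c' ec memc => [|w p] // ec memc sp; rewrite /= rcons_path.
case/andP=> uw /andP[wp lu] /and3P[uwp wnp up'].
have nlu : last w p \in w :: p by apply: mem_last.
have cw : cover r w u.
  case/orP: uw => // /[dup] h /cover_rel /umax e.
  by rewrite -e ?coverxx // in h; apply: memc; rewrite !inE eqxx orbT.
have cl : cover r (last w p) u.
  case/orP: lu => // /[dup] h /cover_rel /umax e.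
  by rewrite e ?coverxx // in h; apply: memc; rewrite inE nlu orbT.
have nwl : w != last w p.
  case: p sp wnp {ec memc wp lu uwp up' nlu cl} => //= z p _; apply: contra => /eqP e.
  by rewrite {1}e mem_last.
have [Ou bu] := children_separated cw cl nwl.
have /hasP[z zp uz] := crossing_above Ou wp uwp bu.
have e : z = u by apply: umax => //; apply: memc; rewrite inE zp orbT.
by rewrite -e zp in uwp.
Qed.

(** Induction on the distance of the labels, written as a sum of two truncated differences: a turn
    between incomparable [x] and [y] is comparable to [x] and closer to [y]. *)
Lemma hasse_connected x y : connect hasse_adj x y.
Proof.
have sub u v : cover r u v -> connect hasse_adj u v.
  by move=> h; apply: connect1; rewrite /hasse_adj /= h.
have subr u v : r u v -> connect hasse_adj u v.
  by rewrite -(connect_cover rr ra rt); apply: connect_sub.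
have sym := sym_connect_sym hasse_adj_sym.
have [_ _ _ rc] := ppr.
have [m] := ubnP ((x - y) + (y - x)); elim: m => // m IH in x y *; rewrite ltnS => xym.
have [xy|nxy] := boolP (r x y); first exact: subr.
have [yx|nyx] := boolP (r y x); first by rewrite sym; apply: subr.
have [b bxy tb] := rc _ _ nxy nyx.
apply: (@connect_trans _ _ b).
  by case/orP: tb => /andP[_ h]; [|rewrite sym]; apply: subr.
apply: IH; apply: leq_trans xym; case/orP: bxy => /andP[h1 h2].
  have -> : b - y = 0 by apply/eqP; rewrite subn_eq0 ltnW.
  by apply: (@leq_trans (y - x)); [rewrite ltn_sub2l // (ltn_trans h1) | rewrite leq_addl].
have -> : y - b = 0 by apply/eqP; rewrite subn_eq0 ltnW.
by rewrite addn0; apply: (@leq_trans (x - y)); [rewrite ltn_sub2r // (ltn_trans h1) | rewrite leq_addr].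
Qed.

(** If [x] and [w] were on different sides of [v], the path joining them off [v] would contain some
    [z] above [v]. Then [z] is also joined off [v] to a parent [u] of [v], and acyclicity identifies
    the child [w] with the parent [u]. *)
Lemma child_subtree_side v w x : v \in Ominus O -> cover r w v ->
  connect (avoid hasse_adj v) w x -> (x < v) = (w < v) /\ (v < x) = (v < w).
Proof.
move=> Ov cwv cwx.
have wv : w != v by apply: contraTneq cwv => ->; rewrite coverxx.
have /connectP[p pp ex] := cwx.
have /andP[wp vp] := path_avoid pp wv.
have xv : x != v by apply: contraNneq vp => <-; rewrite ex mem_last.
have [bwx|nb] := boolP (between v w x); last first.
  move: nb wv xv; rewrite -!val_eqE /between /=.
  by case: (ltngtP v w); case: (ltngtP v x).
have /hasP[z zp vz] : has (r v) (w :: p) by apply: crossing_above => //; rewrite -ex.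
have sym : connect_sym (avoid hasse_adj v).
  exact: sym_connect_sym (avoid_sym v hasse_adj_sym).
have cwz : connect (avoid hasse_adj v) w z.
  by apply: (path_connect pp).
have vnz : v != z by apply: contraNneq vp => ->.
have [u vu uz] : exists2 u, cover r v u & connect (cover r) u z.
  by apply: connect_first => //; rewrite connect_cover.
have uv : u != v by apply: contraTneq vu => ->; rewrite coverxx.
have cuz : connect (avoid hasse_adj v) u z.
  case/connectP: uz => s us ez; apply/connectP; exists s => //.
  apply: avoid_path.
    by apply: sub_path us => a b; rewrite /hasse_adj /= => ->.
  apply/negP => /(path_connect us); rewrite connect_cover // => h.
  exact: (cover_asym ra vu h).
have ewu : w = u.
  apply: (@acyclic_neighbors _ hasse_adj v) => //.
  - exact: hasse_adj_sym.
  - exact: hasse_acyclic.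
  - by rewrite /hasse_adj /= cwv orbT.
  - by rewrite /hasse_adj /= vu.
  - by apply: connect_trans cwz _; rewrite sym.
case: (cover_asym ra cwv); rewrite ewu; exact: cover_rel.
Qed.

End HasseTree.

Definition side_slot n (two : bool) (v w : 'I_n) : slot :=
  if two then if w < v then Left else Right else Only.

Definition hasse_digraph n (O : orientation n) (r : rel 'I_n) : slotted_digraph n :=
  SlottedDigraph (cover r) (fun v => side_slot (v \in Oplus O) v)
    (fun v => side_slot (v \in Ominus O) v).

Lemma cover_opp n (r : rel 'I_n) x y : cover (fun x y => r y x) x y = cover r y x.
Proof.
rewrite /cover eq_sym; congr [&& _, _ & _]; apply: eq_forallb => z.
by rewrite andbC orbC.
Qed.

Lemma side_slot_has n two (v w : 'I_n) : has_slot two (side_slot two v w).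
Proof. by rewrite /side_slot; case: two => //=; case: ltnP => _; [left|right]. Qed.

Lemma hasse_permutree n (O : orientation n) (r : rel 'I_n) :
  permutree_poset O r -> is_permutree O (hasse_digraph O r).
Proof.
move=> ppr; have ppo := permutree_poset_opp ppr.
have [[rr ra rt] _ _ _] := ppr.
have slotsep two (v w w' : 'I_n) :
    side_slot two v w = side_slot two v w' -> two -> ~~ between v w w'.
  rewrite /side_slot => + t2; rewrite t2 /between.
  by case: (ltngtP w v); case: (ltngtP w' v).
split.
- split.
  + by move=> x; rewrite /= coverxx.
  + move=> x y /= cxy; apply/negP => /cover_rel; exact: cover_asym cxy.
  + by move=> x y; apply: (hasse_connected ppr).
  + exact: (hasse_acyclic ppr).
- by split=> v w _; apply: side_slot_has.
(* Neighbours in one slot lie on the same side of [v], whereas distinct children are separated by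
   [v]; parents are children in the reversed poset. *)
- split=> v w w' /= h h' es; apply/eqP/negPn/negP => nww.
    rewrite -cover_opp in h; rewrite -cover_opp in h'.
    have [Ov] := children_separated ppo h h' nww.
    by apply/negP; apply: slotsep es Ov.
  have [Ov] := children_separated ppr h h' nww.
  by apply/negP; apply: slotsep es Ov.
- move=> v w x Ov /= h hx; rewrite -cover_opp in h.
  have [|e1 e2] := @child_subtree_side _ _ _ ppo v w x Ov h.
    rewrite (@eq_connect _ _ (avoid (hasse_adj r) v)) // => a b.
    by rewrite /avoid /hasse_adj /= (cover_opp r a b) (cover_opp r b a) orbC.
  rewrite /side_slot Ov; case: ltnP => // h'; split=> // _; first by rewrite e1.
  rewrite e2 ltn_neqAle h' andbT; apply: contraTneq h => /val_inj ->.
  by rewrite coverxx.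
- move=> v w x Ov /= h hx.
  have [e1 e2] := @child_subtree_side _ _ _ ppr v w x Ov h hx.
  rewrite /side_slot Ov; case: ltnP => // h'; split=> // _; first by rewrite e1.
  rewrite e2 ltn_neqAle h' andbT; apply: contraTneq h => /val_inj ->.
  by rewrite coverxx.
Qed.

(** * The poset of a permutree *)

Definition opp_digraph n (T : slotted_digraph n) : slotted_digraph n :=
  SlottedDigraph (fun x y => edge T y x) (cslot T) (pslot T).

Lemma adj_sym n (T : slotted_digraph n) : symmetric (adj T).
Proof. by move=> x y; rewrite /adj /= orbC. Qed.

Lemma adj_opp n (T : slotted_digraph n) : adj (opp_digraph T) =2 adj T.
Proof. by move=> x y; rewrite /adj /= orbC. Qed.

Lemma in_subtree_opp n (T : slotted_digraph n) v w x :
  in_subtree (opp_digraph T) v w x = in_subtree T v w x.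
Proof.
by apply: eq_connect => a b; rewrite /=; do 2!congr (_ && _); apply: adj_opp.
Qed.

(** Reversal exchanges parents and children, so that only the statements about O- need a direct
    proof. *)
Lemma permutree_opp n (O : orientation n) (T : slotted_digraph n) :
  is_permutree O T -> is_permutree (opp_orientation O) (opp_digraph T).
Proof.
case=> [[t1 t2 t3 t4] [sp sc] [up uc] op om]; split.
- split=> //.
  + by move=> x y /=; apply: t2.
  + by move=> x y; rewrite (eq_connect (adj_opp T)).
  + by move=> c sc' /andP[cc uc']; apply: (t4 c sc'); rewrite /ucycle -(eq_cycle (adj_opp T)) cc.
- by split.
- by split.
- by move=> v w x Ov vw; rewrite in_subtree_opp; apply: om.
- by move=> v w x Ov vw; rewrite in_subtree_opp; apply: op.
Qed.

(** The first backward step, if any, starts at a peak [m]; the condition on the first edge ensures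
    that the path also enters [m] by a forward edge. *)
Lemma directed_prefix n (T : slotted_digraph n) x p :
  path (adj T) x p -> (if p is y :: _ then edge T x y else true) ->
  path (edge T) x p \/ exists p1 m z p2,
    [/\ p = p1 ++ m :: z :: p2, path (edge T) x (rcons p1 m) & edge T z m].
Proof.
elim: p x => [|y [|z p] IH] x; [by left|by move=> _ /= ->; left|].
move=> /andP[_ /[dup] h /andP[yz zp]] exy.
case/orP: yz => eyz.
  have [|[p1 [m [z' [p2 [ep h1 h2]]]]]] := IH _ h eyz.
    by move=> h'; left; rewrite /= exy.
  by right; exists (y :: p1), m, z', p2; rewrite ep /= exy.
by right; exists [::], y, z, p; rewrite /= exy.
Qed.

Section TreePoset.
Variables (n : nat) (O : orientation n) (T : slotted_digraph n).
Hypothesis pT : is_permutree O T.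

Local Notation r := (connect (edge T)).
Local Notation comp m := (connect (avoid (adj T) m)).

Lemma comp_sym m x y : comp m x y = comp m y x.
Proof. exact: sym_connect_sym (avoid_sym m (@adj_sym _ T)) x y. Qed.

Lemma edge_adj x y : edge T x y -> adj T x y.
Proof. by rewrite /adj /= => ->. Qed.

Lemma edge_asym x y : edge T x y -> edge T y x -> False.
Proof. by case: pT => [[_ t2 _ _] _ _ _ _] /t2/negP. Qed.

Lemma edge_neq x y : edge T x y -> x != y.
Proof. by case: pT => [[t1 _ _ _] _ _ _ _]; apply: contraTneq => ->. Qed.

Lemma neighbor_unique v x y : adj T v x -> adj T v y -> comp v x y -> x = y.
Proof.
case: pT => [[_ _ _ t4] _ _ _ _] vx vy; apply: acyclic_neighbors => //.
  exact: adj_sym.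
by case/orP: vx => /edge_neq //; rewrite eq_sym.
Qed.

(** The last vertex before [x] on a simple path from [u] back to [x] is a neighbour of [x] joined to
    [u] off [x], so it equals [u], and the edge between them would go both ways. *)
Lemma no_directed_cycle x u : edge T x u -> r u x -> False.
Proof.
move=> xu /connectP[p0 pp0 ex]; case/shortenP: pp0 ex => p pp up _ ex.
have := edge_neq xu; case/lastP: p ex pp up => [-> |p t]; first by rewrite eqxx.
rewrite last_rcons => <-; rewrite rcons_path -rcons_cons rcons_uniq.
case/andP=> pp ex /andP[xp _] _.
have e : u = last u p.
  apply: (@neighbor_unique x); first exact: edge_adj.
    by rewrite adj_sym edge_adj.
  apply/connectP; exists p => //; apply: avoid_path => //.
  by apply: sub_path pp => a b; apply: edge_adj.
by apply: (edge_asym xu); rewrite {1}e.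
Qed.

Lemma tree_anti : antisymmetric r.
Proof.
move=> x y /andP[xy yx]; apply/eqP/negPn/negP => nxy.
have [u xu uy] := connect_first xy nxy.
exact: no_directed_cycle xu (connect_trans uy yx).
Qed.

Lemma connect_through b x y : r x y -> (r x b /\ r b y) \/ comp b x y.
Proof.
case/connectP=> p pp ->; have [bp|nbp] := boolP (b \in x :: p).
  left; case/splitPl: bp pp => p1 p2 <-; rewrite cat_path last_cat => /andP[h1 h2].
  by split; apply/connectP; [exists p1|exists p2].
right; apply/connectP; exists p => //; apply: avoid_path => //.
by apply: sub_path pp => a b'; apply: edge_adj.
Qed.

(** Distinct children occupy distinct slots, so [m] has two child slots, whose subtrees lie on
    opposite sides of [m]. *)
Lemma peak_between m u z x y : edge T u m -> edge T z m -> u != z ->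
  comp m u x -> comp m z y -> m \in Ominus O /\ between m x y.
Proof.
case: pT => _ [_ sc] [_ uc] _ om um zm nuz ux zy.
have su := sc _ _ um; have sz := sc _ _ zm.
have ns : cslot T m u <> cslot T m z.
  by move=> e; rewrite (uc _ _ _ um zm e) eqxx in nuz.
have [Om|nOm] := boolP (m \in Ominus O); last first.
  by rewrite (negPf nOm) /= in su sz; case: ns; rewrite su sz.
rewrite Om /= in su sz; split=> //; rewrite /between.
have [lu ru] := om _ _ _ Om um ux; have [lz rz] := om _ _ _ Om zm zy.
case: su => eu; case: sz => ez; first [by case: ns; rewrite eu ez | idtac].
  by rewrite (lu eu) (rz ez).
by rewrite (ru eu) (lz ez) orbT.
Qed.

Lemma child_side b w x y : b \in Ominus O -> edge T w b ->
  comp b w x -> comp b w y -> between b x y -> False.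
Proof.
case: pT => _ [_ sc] _ _ om Ob wb wx wy.
have [lx rx] := om _ _ _ Ob wb wx; have [ly ry] := om _ _ _ Ob wb wy.
have := sc _ _ wb; rewrite Ob /between => -[] e.
  by move: (lx e) (ly e); case: (ltngtP x b) => //; case: (ltngtP y b).
by move: (rx e) (ry e); case: (ltngtP b x) => //; case: (ltngtP b y).
Qed.

Lemma first_peak x w p : path (adj T) x (w :: p) -> uniq (x :: w :: p) ->
  edge T x w -> r x (last w p) \/ exists m u z,
    [/\ r x m, edge T u m, edge T z m, u != z
      & comp m u x /\ comp m z (last w p)].
Proof.
move=> pp up xw; have [h|[p1 [m [z [p2 [ep h1 h2]]]]]] := directed_prefix pp xw.
  by left; apply/connectP; exists (w :: p).
have el : last w p = last z p2.
  by rewrite -[last w p]/(last x (w :: p)) ep last_cat.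
right; move: pp up; rewrite {}el {}ep => pp up.
move: h1; rewrite rcons_path => /andP[h1 h3].
exists m, (last x p1), z; move: up.
rewrite -cat_cons cat_uniq => /and3P[_ /hasPn hd /andP[mz _]].
have mp1 : m \notin x :: p1 by apply: hd; rewrite mem_head.
have zp1 : z \notin x :: p1 by apply: hd; rewrite !inE eqxx orbT.
split=> //.
- by apply/connectP; exists (rcons p1 m); rewrite ?rcons_path ?h1 ?last_rcons.
- by apply: contraNneq zp1 => <-; apply: mem_last.
split.
  rewrite comp_sym; apply/connectP; exists p1 => //; apply: avoid_path => //.
  by apply: sub_path h1 => a b; apply: edge_adj.
apply/connectP; exists p2 => //; apply: avoid_path => //.
by move: pp; rewrite cat_path /= => /and4P[].
Qed.

Lemma uniq_adj_path x y : x != y -> exists w p,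
  [/\ path (adj T) x (w :: p), uniq (x :: w :: p) & y = last w p].
Proof.
case: pT => [[_ _ t3 _] _ _ _ _] nxy; have /connectP[p0 pp0 ey] := t3 x y.
case/shortenP: pp0 ey => -[|w p] pp up _ ey; first by rewrite ey eqxx in nxy.
by exists w, p.
Qed.

(* Otherwise the path from b to y turns at a peak m, with b on one side of m
   and y on the other; the directed path from x to y cannot pass through m, so
   x is on the side of y and b is not between x and y. *)
Lemma tree_Ominus b x y : b \in Ominus O -> between b x y -> r x y -> r b y.
Proof.
move=> Ob bxy xy.
have nby : b != y by apply: contraTneq bxy => ->; rewrite /between !ltnn andbF.
have [w [p [pp up ey]]] := uniq_adj_path nby.
have wy : comp b w y.
  apply/connectP; exists p => //; apply: avoid_path; first by case/andP: pp.
  by case/andP: up.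
have [bw|wb] : edge T b w \/ edge T w b by move: pp => /andP[/orP].
  have [h|[m [u [z [bm um zm nuz [ub zl]]]]]] := first_peak pp up bw.
    by rewrite ey.
  rewrite -ey in zl; have [Om mby] := peak_between um zm nuz ub zl.
  (* A directed path through [m] would leave it by a parent [q] in the component of [z], forcing [q]
     to be the child [z]. *)
  have [[xm my]|cxy] := connect_through m xy.
    have nmy : m != y by apply: contraTneq mby => ->; rewrite /between !ltnn andbF.
    have [q mq qy] := connect_first my nmy.
    have [[qm _]|cqy] := connect_through m qy; first by case: (no_directed_cycle mq qm).
    have e : q = z.
      apply: (@neighbor_unique m); first exact: edge_adj.
        by rewrite adj_sym edge_adj.
      by apply: connect_trans cqy _; rewrite comp_sym.
    by case: (edge_asym zm); rewrite -e.
  have zx : comp m z x by apply: connect_trans zl _; rewrite comp_sym.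
  have [_] := peak_between um zm nuz ub zx.
  move: mby bxy; rewrite /between.
  case/orP=> /andP[h1 h2]; case/orP=> /andP[h3 h4]; case/orP=> /andP[h5 h6].
  + by have := ltn_trans (ltn_trans h5 h6) h3; rewrite ltnn.
  + by have := ltn_trans h1 h6; rewrite ltnn.
  + by have := ltn_trans (ltn_trans h1 h2) h3; rewrite ltnn.
  + by have := ltn_trans h1 h6; rewrite ltnn.
  + by have := ltn_trans h5 h2; rewrite ltnn.
  + by have := ltn_trans (ltn_trans h1 h2) h4; rewrite ltnn.
  + by have := ltn_trans h5 h2; rewrite ltnn.
  + by have := ltn_trans (ltn_trans h5 h6) h4; rewrite ltnn.
(* Here the path from [b] to [y] starts at a child [w]: unless the directed path from [x] to [y]
   visits [b], both ends lie in the subtree of [w], on one side of [b]. *)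
have [[]//|cxy] := connect_through b xy.
have wx : comp b w x by apply: connect_trans wy _; rewrite comp_sym.
by case: (child_side Ob wb wx wy bxy).
Qed.

Lemma tree_peak x w p : path (adj T) x (w :: p) -> uniq (x :: w :: p) ->
  edge T x w -> ~~ r x (last w p) ->
  exists2 b, between b x (last w p) & (b \in Ominus O) && r x b.
Proof.
move=> pp up xw nr; have [h|[m [u [z [xm um zm nuz [ux zl]]]]]] := first_peak pp up xw.
  by rewrite h in nr.
by have [Om h] := peak_between um zm nuz ux zl; exists m; rewrite // Om.
Qed.

End TreePoset.

Lemma tree_permutree_poset n (O : orientation n) (T : slotted_digraph n) :
  is_permutree O T -> permutree_poset O (connect (edge T)).
Proof.
move=> pT; have pTo := permutree_opp pT.
have rev x y : connect (edge (opp_digraph T)) x y = connect (edge T) y x.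
  by rewrite connect_rev.
split.
- split; [exact: connect0 | exact: tree_anti pT | exact: connect_trans].
- exact: tree_Ominus pT.
- move=> b x y Ob bxy xy; rewrite -rev.
  by apply: (tree_Ominus pTo Ob) (_ : between b y x) _; rewrite ?rev // betweenC.
- move=> x y nxy nyx.
  have nexy : x != y by apply: contraNneq nxy => ->; apply: connect0.
  have [w [p [pp up ey]]] := uniq_adj_path pT nexy.
  (* A path that starts upwards first turns at a peak in O-; one that starts downwards first turns
     at a valley in O+, which is a peak of the reversed tree. *)
  have [xw|wx] : edge T x w \/ edge T w x by move: pp => /andP[/orP].
    rewrite ey in nxy *; have [b bxy h] := tree_peak pT pp up xw nxy.
    by exists b => //; rewrite /turn h.
  have ppo : path (adj (opp_digraph T)) x (w :: p) by rewrite (eq_path (adj_opp T)).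
  rewrite ey -rev in nyx *; have [b bxy] := tree_peak pTo ppo up wx nyx.
  by rewrite rev => h; exists b => //; rewrite /turn h orbT.
Qed.

(** * Characterisation of permutree element posets and the sublattice property *)

Lemma PEP_permutree_poset n (O : orientation n) (P : label_rel n) :
  PEP O P <-> permutree_poset O (rel_of P).
Proof.
split=> [[T [pT ->]]|pP].
  apply: eq_permutree_poset (tree_permutree_poset pT) => x y.
  by rewrite /rel_of inE.
exists (hasse_digraph O (rel_of P)); split; first exact: hasse_permutree.
have [[rr ra rt] _ _ _] := pP.
by apply/setP=> -[x y]; rewrite inE /= connect_cover.
Qed.

Theorem theorem93 (n : nat) (O : orientation n) :
  induces_sublattice (@weak_le n) (@WOIP n) (PEP O).
Proof.
split=> [P /PEP_permutree_poset/permutree_poset_interval|P Q].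
  by move/WOIP_interval_poset.
move=> /PEP_permutree_poset pP /PEP_permutree_poset pQ; split.
  have [M mM pM] := permutree_poset_meet pP pQ.
  by exists M => //; apply/PEP_permutree_poset.
have [J jJ pJ] := permutree_poset_join pP pQ.
by exists J => //; apply/PEP_permutree_poset.
Qed.
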